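(* Let $\beta\in(1/2,1]$ and let $X$ be skew Brownian motion with parameter $\beta$. Let $g:\mathbb{R}\to[0,\infty)$ satisfy (g1): $g$ is continuous, non-decreasing, non-negative, and has finite left and right derivatives. Assume that either $0\le g'(0-)<g'(0+)$ or $0<g'(0-)\le g'(0+)$, where $g'(0-)$ and $g'(0+)$ are the left and right derivatives of $g$ at $0$. Then for every $r>0$ (for which $g$ satisfies (g2): $\lim_{x\to\infty}g(x)/\psi_r(x)=0$ and $\lim_{x\to-\infty}g(x)/\psi_r(x)=0$), the state $0$ belongs to the continuation region $C=\{x\in\mathbb{R}:V(x)>g(x)\}$, where $V(x)=\sup_{\tau\in\mathcal{T}}\mathbb{E}_x[e^{-r\tau}g(X_\tau)]$.
   Context: Skew Brownian motion (SBM) with parameter $\beta\in[0,1]$ started at $x\in\mathbb{R}$ is the unique strong solution of $X_t=x+W_t+(2\beta-1)\,l_t^X$, where $W$ is a standard Brownian motion and $l^X$ is the (symmetric) local time of $X$ at zero, normalized with respect to Lebesgue measure. Its transition law is, for $t>0$, $$\mathbb{P}_x[X_t\in dy]=\frac{1}{\sqrt{2\pi t}}\left(e^{-\frac{(x-y)^2}{2t}}+(2\beta-1)\,\mathrm{sgn}(y)\,e^{-\frac{(|x|+|y|)^2}{2t}}\right)dy .$$ $\mathbb{P}_x,\mathbb{E}_x$ denote probability and expectation when $X_0=x$. For $r>0$ put $\theta=\sqrt{2r}$ and $$\psi_r(x)=\begin{cases}\frac{1}{2\beta}e^{\theta x}+\left(1-\frac{1}{2\beta}\right)e^{-\theta x},&x\ge0,\\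 e^{\theta x},&x\le0.\end{cases}$$ $\mathcal{T}$ is the set of all stopping times with respect to the natural filtration generated by $X$ (the value $\infty$ is allowed); on $\{\tau=\infty\}$ the convention is $e^{-r\tau}g(X_\tau):=\limsup_{t\to\infty}e^{-rt}g(X_t)$. *)

(* Defs.v *)
(* Processes are indexed by R; only the times in [0, +oo[ matter. *)
From mathcomp Require Export all_boot all_order all_algebra.
From mathcomp Require Export all_classical all_reals all_analysis.
Export Order.TTheory GRing.Theory Num.Theory.
Export numFieldNormedType.Exports.

Set Implicit Arguments.
Unset Strict Implicit.
Unset Printing Implicit Defensive.

Local Open Scope classical_set_scope.
Local Open Scope ring_scope.

Section Processes.
Context (R : realType) (d : measure_display) (T : measurableType d).
Implicit Types (P : probability T R) (X W l : R -> T -> R) (t : R).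

(* Uncompleted natural filtration, sigma(X_s : 0 <= s <= t). *)
Definition natural_filtration X t : set (set T) :=
  <<s [set B | exists (s : R) (A : set R),
        [/\ 0 <= s <= t, measurable A & B = X s @^-1` A]] >>.

Record is_stopping_time X (tau : T -> \bar R) : Prop := {
  stopping_time_ge0 : forall w, (0 <= tau w)%E;
  stopping_time_adapted : forall t, 0 <= t ->
    natural_filtration X t [set w | (tau w <= t%:E)%E] }.

Record is_brownian_motion P W : Prop := {
  bm_measurable : forall t, 0 <= t -> measurable_fun setT (W t);
  bm_start : {ae P, forall w, W 0 w = 0};
  bm_continuous :
    {ae P, forall w, {within `[0, +oo[, continuous (fun t => W t w)}};
  (* the second argument of [normal_prob] is the standard deviation *)
  bm_gaussian : forall (s t : R) (A : set R), 0 <= s < t -> measurable A ->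
    P [set w | A (W t w - W s w)%R] = normal_prob 0 (Num.sqrt (t - s)) A;
  bm_independent : forall (s t : R) (A : set R) (B : set T), 0 <= s < t ->
    measurable A -> natural_filtration W s B ->
    (P (B `&` [set w | A (W t w - W s w)%R]) =
     P B * P [set w | A (W t w - W s w)%R])%E }.

(* [v] is the symmetric local time at zero, up to time [t], of the path [p],
   the occupation measure being taken with respect to Lebesgue measure
   (for a solution of the equation below, d<X>_s = ds). *)
Definition is_local_time0 (p : R -> R) t (v : R) : Prop :=
  (((2 * e)^-1)%:E *
     lebesgue_measure [set s | (0 <= s <= t)%R /\ (`|p s| < e)%R]%classic)%E
    @[e --> 0^'+] --> v%:E.

(* X is adapted to the P-completion of the filtration generated by W. *)
Definition completed_adapted P W X : Prop :=
  forall t (A : set R), 0 <= t -> measurable A ->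
    exists2 B : set T, natural_filtration W t B &
      P.-negligible ((X t @^-1` A `\` B) `|` (B `\` X t @^-1` A)).

(* X is a strong solution of X_t = x + W_t + (2 beta - 1) l_t under P,
   for some Brownian motion W, l being the local time of X at zero. *)
Definition is_sbm_solution (beta : R) P X (x : R) : Prop :=
  exists W l, [/\ is_brownian_motion P W,
    completed_adapted P W X,
    {ae P, forall w, forall t, 0 <= t ->
      is_local_time0 (fun s => X s w) t (l t w)} &
    {ae P, forall w, forall t, 0 <= t ->
      X t w = x + W t w + (2 * beta - 1) * l t w}].

Definition sbm_density (beta t x y : R) : R :=
  (Num.sqrt (2 * pi * t))^-1 *
  (expR (- (x - y) ^+ 2 / (2 * t)) +
   (2 * beta - 1) * Num.sg y * expR (- (`|x| + `|y|) ^+ 2 / (2 * t))).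

(* Skew Brownian motion as a family of laws [Px x] for one continuous
   process X. The transition law is a known property of the solutions of the
   equation (Harrison and Shepp), recorded here as part of the notion. *)
Record is_skew_brownian_motion (beta : R) (Px : R -> probability T R) X
    : Prop := {
  sbm_measurable : forall t, 0 <= t -> measurable_fun setT (X t);
  sbm_continuous :
    forall w, {within `[0, +oo[, continuous (fun t => X t w)};
  sbm_solution : forall x, is_sbm_solution beta (Px x) X x;
  sbm_law : forall x t (A : set R), 0 < t -> measurable A ->
    (Px x (X t @^-1` A) =
     \int[lebesgue_measure]_(y in A) (sbm_density beta t x y)%:E)%E }.

(* e^{-r tau} g(X_tau), with the limsup convention on {tau = +oo}. *)
Definition reward (r : R) (g : R -> R) X (tau : T -> \bar R) (w : T)
    : \bar R :=
  match tau w with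
  | EFin t => (expR (- (r * t)) * g (X t w))%:E
  | _ => limf_esup (fun t => (expR (- (r * t)) * g (X t w))%:E)
           (pinfty_nbhs R)
  end.

Definition value_function (Px : R -> probability T R) X (r : R) (g : R -> R)
    (x : R) : \bar R :=
  ereal_sup [set (\int[Px x]_w reward r g X tau w)%E
            | tau in is_stopping_time X].

Definition continuation_region (Px : R -> probability T R) X (r : R)
    (g : R -> R) : set R :=
  [set x | ((g x)%:E < value_function Px X r g x)%E].

End Processes.

Section Payoffs.
Context (R : realType).
Implicit Types (g : R -> R) (x : R).

Definition diff_quotient g x (h : R) : R := h^-1 * (g (x + h) - g x).

(* g'(x-) and g'(x+); meaningful when the limits exist. *)
Definition left_derivative g x : R := lim (diff_quotient g x @ 0^'-).
Definition right_derivative g x : R := lim (diff_quotient g x @ 0^'+).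

Record condition_g1 g : Prop := {
  g1_continuous : continuous g;
  g1_nondecreasing : {homo g : x y / x <= y};
  g1_ge0 : forall x, 0 <= g x;
  g1_left : forall x, cvg (diff_quotient g x @ 0^'-);
  g1_right : forall x, cvg (diff_quotient g x @ 0^'+) }.

Definition sbm_psi (beta r x : R) : R :=
  let theta := Num.sqrt (2 * r) in
  if 0 <= x then
    (2 * beta)^-1 * expR (theta * x) +
    (1 - (2 * beta)^-1) * expR (- (theta * x))
  else expR (theta * x).

Definition condition_g2 (beta r : R) g : Prop :=
  (g x / sbm_psi beta r x @[x --> +oo] --> 0) /\
  (g x / sbm_psi beta r x @[x --> -oo] --> 0).

End Payoffs.

(* Main.v *)
Require Import Defs.
From mathcomp Require Import ring lra measurable_realfun.

(* A deterministic time t = s^2, with s small, already beats stopping at 0.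
   Under P_0 the density of X_t is the centred Gaussian of variance t, weighted
   by 2 beta on the right and 2 (1 - beta) on the left, so folding y onto -y
   turns E_0[g(X_t)] into the Gaussian mean of
     beta g(|y|) + (1 - beta) g(-|y|) >= g(0) + K |y|   for |y| < delta,
   where 0 < K < beta g'(0+) - (1 - beta) g'(0-). The kink therefore contributes
   a gain of order s = sqrt t, whereas the tails |y| >= delta and the discount
   factor e^{-rt} cost only O(s^2). *)

Set Implicit Arguments.
Unset Strict Implicit.

Local Open Scope classical_set_scope.
Local Open Scope ring_scope.

(** * Integration against a density and under reflection *)

(** A function with the right integral over every measurable set agrees almost everywhere with the
    Radon-Nikodym derivative, for which change of variables is known. *)
Lemma integral_density d (T : measurableType d) (R : realType)
    (nu : {finite_measure set T -> \bar R})
    (mu : {sigma_finite_measure set T -> \bar R}) (p f : T -> \bar R) :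
  measurable_fun setT p -> (forall x, 0 <= p x)%E ->
  (forall A, measurable A -> nu A = \int[mu]_(x in A) p x)%E ->
  measurable_fun setT f -> (forall x, 0 <= f x)%E ->
  (\int[nu]_x f x = \int[mu]_x (f x * p x))%E.
Proof.
move=> mp p0 nup mf f0.
have numu : nu `<< mu.
  apply/null_content_dominatesP => A mA muA0; rewrite nup//.
  by apply: null_set_integral => //; exact: measurable_funTS.
have mrn := measurable_int _ (Radon_Nikodym_SigmaFinite.f_integrable numu).
rewrite -(Radon_Nikodym_SigmaFinite.change_of_variables numu)//.
have rnp : ae_eq mu setT (Radon_Nikodym_SigmaFinite.f nu mu) p.
  apply: integral_ae_eq => //.
    exact: Radon_Nikodym_SigmaFinite.f_integrable.
  by move=> A _ mA; rewrite -nup// -Radon_Nikodym_SigmaFinite.f_integral.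
apply: ae_eq_integral => //.
- exact: emeasurable_funM.
- exact: emeasurable_funM.
- by apply: filterS rnp => x /= rnp _; rewrite rnp.
Qed.

Lemma ge0_integralN (R : realType) (f : R -> \bar R) :
  measurable_fun setT f -> (forall x, 0 <= f x)%E ->
  (\int[lebesgue_measure]_x f (- x)%R = \int[lebesgue_measure]_x f x)%E.
Proof.
move=> mf f0.
transitivity (\int[pushforward lebesgue_measure
    (-%R : R -> measurableTypeR R)]_x f x)%E.
  by rewrite ge0_integral_pushforward//= preimage_setT.
by apply: eq_measure_integral => A mA _; exact: lebesgue_measureN.
Qed.

(** * One-sided slopes of the payoff at 0 *)

Lemma symmetrized_increment (R : realType) (beta : R) (g : R -> R) (K : R) :
  0 <= beta <= 1 -> condition_g1 g ->
  0 <= K < beta * right_derivative g 0 - (1 - beta) * left_derivative g 0 ->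
  exists2 delta, 0 < delta & forall h, 0 < h < delta ->
    g 0 + K * h <= beta * g h + (1 - beta) * g (- h).
Proof.
move=> /andP[b0 b1] g1 /andP[K0].
set D := right_derivative g 0; set L := left_derivative g 0 => KDL.
have gD : diff_quotient g 0 h @[h --> 0^'+] --> D := g1_right g1 (x := 0).
have gL : diff_quotient g 0 h @[h --> 0^'-] --> L := g1_left g1 (x := 0).
clearbody D L.
(* An error [e] in each one-sided slope, weighted by [beta] and [1 - beta], costs [e] in total, so
   [e] is taken to be the whole slack. *)
have [e e0 KE] : exists2 e, 0 < e & K = beta * D - (1 - beta) * L - e.
  by exists (beta * D - (1 - beta) * L - K); lra.
have /cvgrPdist_lt/(_ e e0)[/= d2 d20 H2] := gD.
have /cvgrPdist_lt/(_ e e0)[/= d1 d10 H1] := gL.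
exists (Num.min d1 d2); first by rewrite lt_min d10.
move=> h; rewrite lt_min => /and3P[h0 hd1 hd2].
have := H1 (- h); have := H2 h.
rewrite /= !sub0r opprK normrN gtr0_norm// oppr_lt0.
move=> /(_ hd2 h0) {}H2 /(_ hd1 h0) {}H1.
move: H1 H2; rewrite /diff_quotient !add0r !ltr_norml => /andP[H1 _] /andP[_ H2].
have {}H2 : (D - e) * h < g h - g 0 by rewrite -ltr_pdivlMr// mulrC; lra.
have {}H1 : - (L + e) * h < g (- h) - g 0.
  by rewrite -ltr_pdivlMr// mulrC; move: H1; rewrite invrN; lra.
have B2 := ler_wpM2l b0 (ltW H2).
have B1 : (1 - beta) * (- (L + e) * h) <= (1 - beta) * (g (- h) - g 0).
  by apply: ler_wpM2l; [lra|exact: ltW].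
suff -> : K * h = beta * ((D - e) * h) + (1 - beta) * (- (L + e) * h) by lra.
by rewrite KE; ring.
Qed.

(** * Transition density from 0 and Gaussian estimates *)

(** From 0 the two exponentials coincide, so skewness only multiplies the Gaussian density by a
    weight depending on the sign of [y]. Writing time as [s ^+ 2] makes [s] the standard
    deviation. *)
Lemma sbm_density0 (R : realType) (beta s y : R) : 0 < s ->
  sbm_density beta (s ^+ 2) 0 y =
  normal_pdf 0 s y * (1 + (2 * beta - 1) * Num.sg y).
Proof.
move=> s0; rewrite normal_pdfE ?gt_eqF// /normal_peak /normal_fun /sbm_density.
rewrite normr0 !add0r sqrrN subr0 real_normK ?num_real//.
have -> : 2 * pi * s ^+ 2 = s ^+ 2 * pi *+ 2 by ring.
by rewrite [2 * s ^+ 2]mulr_natl; ring.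
Qed.

(* Bounds the tail by O(s^2) times a density of integral 1, which avoids any
   tail estimate. *)
Lemma normal_pdf_tail (R : realType) (s y delta : R) :
  0 < s -> 0 < delta -> delta <= `|y| ->
  normal_pdf 0 s y <= 6 * s ^+ 2 / delta ^+ 2 * normal_pdf 0 (2 * s) y.
Proof.
move=> s0 d0 dy; have s20 : 0 < 2 * s by lra.
rewrite !normal_pdfE ?gt_eqF// /normal_fun subr0.
have -> : normal_peak (2 * s) = normal_peak s / 2.
  rewrite /normal_peak exprMn -[_ * _ * pi]mulrA -mulrnAr sqrtrM ?exprn_ge0//.
  by rewrite sqrtr_sqr ger0_norm// invfM mulrC.
(* Split 1/2 = 1/8 + 3/8: the first share is the exponent for deviation [2 * s], the second is the
   decay still to be exploited. *)
have -> : - y ^+ 2 / (s ^+ 2 *+ 2) =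
    - y ^+ 2 / ((2 * s) ^+ 2 *+ 2) - 3 * y ^+ 2 / (8 * s ^+ 2).
  by field; rewrite gt_eqF.
set u := 3 * y ^+ 2 / (8 * s ^+ 2).
have dy2 : delta ^+ 2 <= y ^+ 2.
  by rewrite -[y ^+ 2]real_normK ?num_real// ler_sqr ?nnegrE// ltW.
have s2 : 0 < s ^+ 2 by rewrite exprn_gt0.
have d2 : 0 < delta ^+ 2 by rewrite exprn_gt0.
have u0 : 0 < u by rewrite divr_gt0; lra.
(* By 1 + u <= e^u, the left side is at most 1/u; 8/3 is rounded up to 3, and the halved peak
   doubles this to the 6 of the statement. *)
have eu : expR (- u) <= 3 * s ^+ 2 / delta ^+ 2.
  apply: (@le_trans _ _ u^-1).
    rewrite expRN lef_pV2 ?posrE ?expR_gt0//.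
    by apply: le_trans (expR_ge1Dx u); lra.
  rewrite /u invf_div ler_pdivrMr; last lra.
  rewrite mulrAC ler_pdivlMr//.
  have := ler_wpM2l (ltW s2) dy2; have := mulr_gt0 s2 d2; lra.
rewrite expRD.
have := normal_peak_ge0 s; have := expR_ge0 (- y ^+ 2 / ((2 * s) ^+ 2 *+ 2)).
set a := expR _; set b := normal_peak s => a0 b0.
have := ler_wpM2l (mulr_ge0 b0 a0) eu; lra.
Qed.

Lemma normal_pdf_bulk (R : realType) (s y : R) : 0 < s -> `|y| <= 2 * s ->
  normal_pdf 0 s (2 * s) <= normal_pdf 0 s y.
Proof.
move=> s0 ys; rewrite !normal_pdfE ?gt_eqF// ler_wpM2l ?normal_peak_ge0//.
rewrite ler_expR !subr0 !mulNr lerN2 ler_wpM2r//.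
  by rewrite invr_ge0 mulrn_wge0// exprn_ge0// ltW.
by rewrite -[y ^+ 2]real_normK ?num_real// ler_sqr ?nnegrE//; lra.
Qed.

(** This scaling makes the gain linear in [s]: an increment [K * s] over an interval of length [s]
    meets a density of order 1/s. *)
Lemma normal_pdf_2sd (R : realType) (s : R) : 0 < s ->
  s * normal_pdf 0 s (2 * s) = normal_pdf 0 1 2.
Proof.
move=> s0; rewrite !normal_pdfE ?gt_eqF// /normal_peak /normal_fun !subr0.
have -> : - (2 * s) ^+ 2 / (s ^+ 2 *+ 2) = - 2 ^+ 2 / (1 ^+ 2 *+ 2) :> R.
  by field; rewrite gt_eqF.
rewrite -mulrnAr sqrtrM ?exprn_ge0 ?ltW// sqrtr_sqr gtr0_norm//.
by rewrite expr1n mul1r invfM !mulrA divff ?gt_eqF// mul1r.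
Qed.

Lemma sbm_density0_ge0 (R : realType) (beta s y : R) :
  0 <= beta <= 1 -> 0 < s -> 0 <= sbm_density beta (s ^+ 2) 0 y.
Proof.
move=> /andP[b0 b1] s0; rewrite sbm_density0// mulr_ge0 ?normal_pdf_ge0//.
by case: sgrP => _; lra.
Qed.

Lemma measurable_sbm_density0 (R : realType) (beta s : R) : 0 < s ->
  measurable_fun setT (sbm_density beta (s ^+ 2) 0).
Proof.
move=> s0; rewrite (_ : sbm_density _ _ _ = fun y =>
  normal_pdf 0 s y * (1 + (2 * beta - 1) * Num.sg y)); last first.
  by apply/funext => y; exact: sbm_density0.
apply: measurable_funM; first exact: measurable_normal_pdf.
apply: measurable_funD => //; apply: measurable_funM => //.
apply: nondecreasing_measurable => // x y xy.
by case: sgrP xy => hx; case: sgrP => hy; lra.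
Qed.

(** * Folding and the lower bound on the mean *)

(** Whatever the sign of a nonzero [y], the point [|y|] carries weight 2 beta and [-|y|] carries 2
    (1 - beta). At 0 both weights are 1, with the same total. *)
Lemma sbm_density0_symmetrized (R : realType) (beta s : R) (g : R -> R) (y : R) :
  0 < s ->
  g y * sbm_density beta (s ^+ 2) 0 y +
    g (- y) * sbm_density beta (s ^+ 2) 0 (- y) =
  2 * normal_pdf 0 s y * (beta * g `|y| + (1 - beta) * g (- `|y|)).
Proof.
move=> s0; rewrite !sbm_density0// sgrN.
have -> : normal_pdf 0 s (- y) = normal_pdf 0 s y.
  by rewrite !normal_pdfE ?gt_eqF// /normal_fun !subr0 sqrrN.
by case: sgrP => [->|y0|y0]; rewrite ?oppr0 ?opprK; ring.
Qed.

(* The linear gain K |y| is kept only on [s, 2 s], where it is at least K s and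
   the density is at least its value at 2 s. *)
Lemma normal_pdf_kink_lb (R : realType) (beta s delta K : R) (g : R -> R) (y : R) :
  0 <= beta <= 1 -> {homo g : x y / x <= y} -> (forall x, 0 <= g x) ->
  0 <= K -> 0 < s -> 2 * s < delta ->
  (forall h, 0 < h < delta ->
    g 0 + K * h <= beta * g h + (1 - beta) * g (- h)) ->
  g 0 * normal_pdf 0 s y +
    K * s * normal_pdf 0 s (2 * s) * \1_(`[s, 2 * s]) y <=
  normal_pdf 0 s y * (beta * g `|y| + (1 - beta) * g (- `|y|)) +
    6 * s ^+ 2 / delta ^+ 2 * g 0 * normal_pdf 0 (2 * s) y.
Proof.
move=> /andP[b0 b1] gnd g0 K0 s0 sd gK.
have p0 := normal_pdf_ge0 0 s y; have p20 := normal_pdf_ge0 0 (2 * s) y.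
have C0 : 0 <= 6 * s ^+ 2 / delta ^+ 2 * g 0.
  by rewrite mulr_ge0// divr_ge0 ?sqr_ge0// pmulr_rge0 ?sqr_ge0.
have Cp0 := mulr_ge0 C0 p20.
(* Far out the indicator vanishes, because 2 s < delta, and the tail term alone dominates [g 0]
   times the density. *)
have [dy|yd] := leP delta `|y|.
  rewrite indicE memNset ?mulr0 ?addr0; last first.
    rewrite /= in_itv/= => /andP[sy ys].
    by move: dy; rewrite ger0_norm; lra.
  have := ler_wpM2r (g0 0) (normal_pdf_tail s0 _ dy) => /(_ ltac:(lra)) H.
  have : 0 <= normal_pdf 0 s y * (beta * g `|y| + (1 - beta) * g (- `|y|)).
    by rewrite mulr_ge0// addr_ge0 ?mulr_ge0//; lra.
  by move: H; lra.
have gB : g 0 + K * `|y| <= beta * g `|y| + (1 - beta) * g (- `|y|).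
  have [->|y0] := eqVneq y 0; first by rewrite normr0 oppr0; lra.
  by apply: gK; rewrite normr_gt0 y0.
have gBp := ler_wpM2l p0 gB.
suff : K * s * normal_pdf 0 s (2 * s) * \1_(`[s, 2 * s]) y <=
    normal_pdf 0 s y * (K * `|y|) by lra.
rewrite indicE; have [|_] := boolP (y \in _); last first.
  by rewrite mulr0 !mulr_ge0.
rewrite inE /= in_itv/= => /andP[sy ys]; rewrite ger0_norm; last lra.
have := @normal_pdf_bulk _ s y s0; rewrite ger0_norm; last lra.
move=> /(_ ys) H; rewrite mulr1 [leRHS]mulrC.
by apply: ler_pM => //; [exact/mulr_ge0/ltW|exact: normal_pdf_ge0|exact: ler_wpM2l].
Qed.

(** The pointwise bound is integrated over the whole line, where F(y) + F(-y) has twice the integral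
    of F; hence the factors 2 in [lo] and [hi]. *)
Lemma sbm_density0_integral_lb (R : realType) (beta s delta K : R) (g : R -> R) :
  0 <= beta <= 1 -> {homo g : x y / x <= y} -> (forall x, 0 <= g x) ->
  0 <= K -> 0 < s -> 2 * s < delta ->
  (forall h, 0 < h < delta ->
    g 0 + K * h <= beta * g h + (1 - beta) * g (- h)) ->
  ((g 0 + K * normal_pdf 0 1 2 * s - 6 / delta ^+ 2 * g 0 * s ^+ 2)%:E <=
   \int[lebesgue_measure]_y (g y * sbm_density beta (s ^+ 2) 0 y)%:E)%E.
Proof.
move=> hb gnd g0 K0 s0 sd gK.
set F := fun y => g y * sbm_density beta (s ^+ 2) 0 y.
have F0 y : 0 <= F y by rewrite mulr_ge0 ?sbm_density0_ge0.
have mF : measurable_fun setT F.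
  apply: measurable_funM; last exact: measurable_sbm_density0.
  exact: nondecreasing_measurable.
have mFN : measurable_fun setT (fun y : R => F (- y)).
  by apply: measurableT_comp => //; exact: oppr_measurable.
pose c := K * s * normal_pdf 0 s (2 * s).
have c0 : 0 <= c by rewrite !mulr_ge0 ?normal_pdf_ge0// ltW.
pose C := 6 * s ^+ 2 / delta ^+ 2 * g 0.
have C0 : 0 <= C.
  by rewrite mulr_ge0// divr_ge0 ?sqr_ge0// pmulr_rge0 ?sqr_ge0.
(* The tail loss is added to [hi] instead of subtracted from [lo]: both integrands stay nonnegative,
   so monotonicity applies even if F has infinite integral. *)
pose lo := (fun y : R => (2 * g 0)%:E * (normal_pdf 0 s y)%:E +
  (2 * c)%:E * (\1_(`[s, 2 * s]) y)%:E)%E.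
pose hi := (fun y : R => (F y)%:E + (F (- y))%:E +
  (2 * C)%:E * (normal_pdf 0 (2 * s) y)%:E)%E.
have mpdf u : measurable_fun setT (fun y : R => (normal_pdf (0 : R) u y)%:E).
  by apply/measurable_EFinP; exact: measurable_normal_pdf.
have mind : measurable_fun setT (fun y : R => (\1_(`[s, 2 * s]) y : R)%:E).
  by apply/measurable_EFinP; exact: measurable_indic.
have pdf0 u y : (0 <= (normal_pdf (0 : R) u y)%:E)%E.
  by rewrite lee_fin normal_pdf_ge0.
have ind0 (y : R) : (0 <= (\1_(`[s, 2 * s]) y : R)%:E)%E by rewrite lee_fin.
have g20 : (0 <= (2 * g 0)%:E)%E by rewrite lee_fin mulr_ge0.
have c20 : (0 <= (2 * c)%:E)%E by rewrite lee_fin mulr_ge0.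
have C20 : (0 <= (2 * C)%:E)%E by rewrite lee_fin mulr_ge0.
have le_lohi y : (lo y <= hi y)%E.
  rewrite /lo /hi -!EFinM -!EFinD lee_fin sbm_density0_symmetrized//.
  have := @normal_pdf_kink_lb _ beta s delta K g y hb gnd g0 K0 s0 sd gK.
  by rewrite -/c -/C; lra.
have intlo : (\int[lebesgue_measure]_y lo y = (2 * g 0 + 2 * c * s)%:E)%E.
  rewrite ge0_integralD//=.
  - rewrite !ge0_integralZl//; last exact: mpdf.
    rewrite integral_normal_pdf integral_indic//= setIT lebesgue_measure_itv/=.
    rewrite lte_fin ifT; last lra.
    by rewrite mule1 -EFinD; congr EFin; ring.
  - by move=> y _; rewrite mule_ge0.
  - by apply: measurable_funeM; exact: mpdf.
  - by move=> y _; rewrite mule_ge0.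
  - by apply: measurable_funeM; exact: mind.
have mF' : measurable_fun setT (fun y => (F y)%:E) by exact/measurable_EFinP.
have mFN' : measurable_fun setT (fun y : R => (F (- y))%:E).
  exact/measurable_EFinP.
have F0' y : (0 <= (F y)%:E)%E by rewrite lee_fin.
have mFF : measurable_fun setT (fun y : R => (F y)%:E + (F (- y))%:E)%E.
  by apply: emeasurable_funD; [exact: mF'|exact: mFN'].
have mtail : measurable_fun setT
    (fun y : R => (2 * C)%:E * (normal_pdf 0 (2 * s) y)%:E)%E.
  by apply: measurable_funeM; exact: mpdf.
have inthi : (\int[lebesgue_measure]_y hi y =
    2%:E * \int[lebesgue_measure]_y (F y)%:E + (2 * C)%:E)%E.
  rewrite ge0_integralD//.
  - congr adde.
    + rewrite ge0_integralD//.
      by rewrite (ge0_integralN mF' F0') -mule2n mule_natl.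
    + rewrite ge0_integralZl//; last exact: mpdf.
      by rewrite integral_normal_pdf mule1.
  - by move=> y _; rewrite adde_ge0.
  - by move=> y _; rewrite mule_ge0.
have : (\int[lebesgue_measure]_y lo y <= \int[lebesgue_measure]_y hi y)%E.
  apply: ge0_le_integral => //.
  - by move=> y _; rewrite /lo adde_ge0// mule_ge0.
  - apply: emeasurable_funD; apply: measurable_funeM;
      by [exact: mpdf|exact: mind].
  - by apply: emeasurable_funD; [exact: mFF|exact: mtail].
rewrite intlo inthi.
have : (0 <= \int[lebesgue_measure]_y (F y)%:E)%E.
  by apply: integral_ge0 => y _; rewrite lee_fin.
(* Only a finite integral needs the comparison; an infinite one exceeds any bound. *)
case: (\int[lebesgue_measure]_y (F y)%:E)%E => [I| |]//= _; last by rewrite leey.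
rewrite -EFinM -EFinD !lee_fin (_ : c = K * normal_pdf 0 1 2); last first.
  by rewrite /c -mulrA normal_pdf_2sd.
rewrite (_ : C = 6 / delta ^+ 2 * g 0 * s ^+ 2); last by rewrite /C; ring.
lra.
Qed.

(** * Expected payoff at deterministic times *)

Lemma sbm_expectation0 (R : realType) (d : measure_display)
    (T : measurableType d) (Px : R -> probability T R) (X : R -> T -> R)
    (beta s : R) (g : R -> R) :
  0 <= beta <= 1 -> is_skew_brownian_motion beta Px X -> 0 < s ->
  measurable_fun setT g -> (forall x, 0 <= g x) ->
  (\int[Px 0%R]_w (g (X (s ^+ 2) w))%:E =
   \int[lebesgue_measure]_y (g y * sbm_density beta (s ^+ 2) 0 y)%:E)%E.
Proof.
move=> hb sbm s0 mg g0; have t0 : 0 < s ^+ 2 by rewrite exprn_gt0.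
have mX := sbm_measurable sbm (ltW t0).
pose Y : {RV (Px 0) >-> measurableTypeR R} :=
  @mfun_Sub _ _ T (measurableTypeR R) (X (s ^+ 2)) (mem_set mX).
rewrite -(@ge0_integral_distribution _ _ _ _ _ _ Y (EFin \o g))//; last first.
  exact/measurable_EFinP.
rewrite (@integral_density _ _ R (distribution (Px 0) Y) (@lebesgue_measure R)
  (fun y => (sbm_density beta (s ^+ 2) 0 y)%:E) (EFin \o g))//.
- by apply/measurable_EFinP; exact: measurable_sbm_density0.
- by move=> y; rewrite lee_fin sbm_density0_ge0.
- by move=> A mA; rewrite -(sbm_law sbm).
- exact/measurable_EFinP.
Qed.

Lemma is_stopping_time_cst (R : realType) (d : measure_display)
    (T : measurableType d) (X : R -> T -> R) (t : R) : 0 <= t ->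
  is_stopping_time X (cst t%:E).
Proof.
move=> t0; split=> [w|u u0]; first by rewrite lee_fin.
rewrite /cst; case: (t%:E <= u%:E)%E.
  rewrite [X in natural_filtration _ _ X](_ : _ = setT); last exact: set_true.
  by rewrite -setC0; apply: sigma_algebraC; exact: sigma_algebra0.
rewrite [X in natural_filtration _ _ X](_ : _ = set0); last exact: set_false.
exact: sigma_algebra0.
Qed.

(** * Choice of a time that beats immediate stopping *)

Theorem proposition4p1 (R : realType) (d : measure_display)
    (T : measurableType d) (Px : R -> probability T R) (X : R -> T -> R)
    (beta : R) (g : R -> R) :
  2^-1 < beta <= 1 ->
  is_skew_brownian_motion beta Px X ->
  condition_g1 g ->
  (0 <= left_derivative g 0 < right_derivative g 0 \/
   0 < left_derivative g 0 <= right_derivative g 0) ->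
  forall r : R, 0 < r -> condition_g2 beta r g ->
  continuation_region Px X r g 0.
Proof.
move=> /andP[b12 b1] sbm g1 hg r r0 _.
have hb : 0 <= beta <= 1 by rewrite b1 andbT; lra.
set L := left_derivative g 0 in hg; set D := right_derivative g 0 in hg.
(* This is beta (D - L) + (2 beta - 1) L, with both terms nonnegative since beta > 1/2; each
   alternative makes one of them positive. *)
have kink : 0 < beta * D - (1 - beta) * L by case: hg => /andP[? ?]; nra.
pose K := (beta * D - (1 - beta) * L) / 2.
have K0 : 0 < K by rewrite divr_gt0.
have [delta d0 gK] : exists2 delta, 0 < delta & forall h, 0 < h < delta ->
    g 0 + K * h <= beta * g h + (1 - beta) * g (- h).
  by apply: symmetrized_increment => //; rewrite -/L -/D /K; lra.
have gnd := g1_nondecreasing g1; have g0 := g1_ge0 g1.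
pose kappa := K * normal_pdf 0 1 2.
have kappa0 : 0 < kappa.
  by rewrite mulr_gt0// normal_pdfE// mulr_gt0 ?normal_peak_gt0 ?expR_gt0.
pose C := 6 / delta ^+ 2 * g 0.
have C0 : 0 <= C by rewrite mulr_ge0// divr_ge0 ?sqr_ge0.
(* Coefficient of the losses of order s^2: the tail, the discount on [g 0], and the discount on the
   gain, where s^3 <= s^2. *)
pose M := C + r * g 0 + r * kappa.
have M0 : 0 <= M by rewrite !addr_ge0// mulr_ge0// ltW.
have [s [s0 s1 sd sM]] : exists s, [/\ 0 < s, s <= 1, 2 * s < delta & s * M < kappa].
  (* The denominator [M + 1] and the quarter of [delta] make the last two bounds strict. *)
  exists (Num.min 1 (Num.min (delta / 4) (kappa / (M + 1)))).
  have M1 : 0 < M + 1 by lra.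
  have q0 : 0 < kappa / (M + 1) by rewrite divr_gt0.
  set s := Num.min _ _.
  have s0 : 0 < s by rewrite !lt_min; apply/and3P; split=> //; lra.
  have : s <= s by [].
  rewrite {2}/s !le_min => /and3P[s1 sd]; rewrite ler_pdivlMr// => sM.
  by split=> //; [lra|lra].
apply: (@lt_le_trans _ _
  (\int[Px 0%R]_w reward r g X (cst (s ^+ 2)%:E) w)%E); last first.
  apply: ereal_sup_ubound; exists (cst (s ^+ 2)%:E) => //.
  by apply: is_stopping_time_cst; rewrite sqr_ge0.
have mg : measurable_fun setT g by exact: nondecreasing_measurable.
have mX : measurable_fun setT (X (s ^+ 2)).
  by apply: (sbm_measurable sbm); rewrite sqr_ge0.
rewrite /reward /=; under eq_integral do rewrite EFinM.
rewrite ge0_integralZl//; last 2 first.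
- by apply/measurable_EFinP; exact: measurableT_comp.
- by move=> w _; rewrite lee_fin.
rewrite (sbm_expectation0 hb sbm)//.
have lb := sbm_density0_integral_lb hb gnd g0 (ltW K0) s0 sd gK.
have e0 : (0 <= (expR (- (r * s ^+ 2)))%:E)%E by rewrite lee_fin expR_ge0.
apply: lt_le_trans (lee_wpmul2l e0 lb).
rewrite -EFinM lte_fin -/kappa -/C.
set J := _ - _.
have J0 : 0 <= J.
  have : 0 <= s * (kappa - s * M) by rewrite mulr_ge0 ?subr_ge0// ltW.
  have : 0 <= s ^+ 2 * (r * g 0 + r * kappa).
    by rewrite mulr_ge0 ?sqr_ge0// addr_ge0// mulr_ge0// ltW.
  by rewrite /J /M; have := g0 0; lra.
(* Linearizing the discount factor preserves the inequality because [J] is nonnegative. *)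
apply: (@lt_le_trans _ _ ((1 - r * s ^+ 2) * J)); last first.
  by rewrite ler_wpM2r// (le_trans _ (expR_ge1Dx _)).
(* The expanded product exceeds [g 0] by exactly the sum of this term and the next two. *)
have : 0 < s * (kappa - s * M) by rewrite mulr_gt0// subr_gt0.
have : 0 <= r * C * s ^+ 4.
  by apply: mulr_ge0; [exact/mulr_ge0/C0/ltW|exact/exprn_ge0/ltW].
have : 0 <= r * kappa * s ^+ 2 * (1 - s).
  apply: mulr_ge0; last by rewrite subr_ge0.
  by apply: mulr_ge0; [apply: mulr_ge0; exact: ltW|exact: sqr_ge0].
rewrite /J /M; lra.
Qed.
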